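(* Let $\alpha\in\mathbb{R}$, $b\in\mathbb{N}$, $b\ge2$. There is a constant $C=C(\alpha,b)>0$ such that for all $x\in\mathbb{R}$ and all $t\in\mathbb{R}\setminus\{0\}$, $$\Big|\int_{\mathbb{R}}e^{i(t\xi^b+x\xi)}|\xi|^\alpha\,d\xi\Big|\le C\begin{cases}(|t|^{1/b}+|x|)^{-\alpha-1}, & \text{if } -1<\alpha\le-\tfrac12,\\[2pt] (|t|^{1/b}+|x|)^{\frac1{b-1}\left(\alpha-\frac b2+1\right)}\,|t|^{\frac1{b-1}\left(-\alpha-\frac12\right)}, & \text{if } -\tfrac12<\alpha<b-1.\end{cases}$$
   Context: The integral over $\mathbb{R}$ is understood as an (in general conditionally convergent) improper integral, i.e. as the limit of the integrals over $[-R_1,R_2]$ as $R_1,R_2\to\infty$. *)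

(* Defs.v *)
From HB Require Import structures.
From mathcomp Require Import all_boot all_order all_algebra.
From mathcomp Require Import complex.
From mathcomp Require Import all_classical all_reals all_analysis.

Set Implicit Arguments.
Unset Strict Implicit.
Unset Printing Implicit Defensive.

Import Order.TTheory GRing.Theory Num.Theory.
Import numFieldNormedType.Exports.

Local Open Scope classical_set_scope.
Local Open Scope ring_scope.
Local Open Scope complex_scope.

Definition cexp (R : realType) (z : R[i]) : R[i] :=
  (expR (complex.Re z))%:C * (cos (complex.Im z) +i* sin (complex.Im z)).

Section complex_integral.
Variable R : realType.
Local Notation mu := (@lebesgue_measure R).

Definition cintegrable (D : set R) (f : R -> R[i]) : Prop :=
  mu.-integrable D (EFin \o (fun x => complex.Re (f x))) /\
  mu.-integrable D (EFin \o (fun x => complex.Im (f x))).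

Definition cintegral (D : set R) (f : R -> R[i]) : R[i] :=
  (\int[mu]_(x in D) complex.Re (f x)) +i* (\int[mu]_(x in D) complex.Im (f x)).

(* The regular-module alias [R[i]^o] gives the complex numbers the topology of
   their modulus. *)
Definition truncated_integral (f : R -> R[i]) (p : R * R) : R[i]^o :=
  cintegral `[- p.1, p.2] f.

(* [R1] and [R2] tend to [+oo] independently: this is not a principal value.
   Integrability on the truncated intervals is required because [cintegral]
   takes a junk value on non-integrable functions. *)
Definition improper_integrable (f : R -> R[i]) : Prop :=
  (forall R1 R2 : R, cintegrable `[- R1, R2] f) /\
  cvg (truncated_integral f p @[p --> (+oo%R, +oo%R)]).

Definition improper_integral (f : R -> R[i]) : R[i] :=
  lim (truncated_integral f p @[p --> (+oo%R, +oo%R)]).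

End complex_integral.

(* Main.v *)
Require Import Defs.
From HB Require Import structures.
From mathcomp Require Import all_boot all_order all_algebra.
From mathcomp Require Import complex.
From mathcomp Require Import all_classical all_reals all_analysis.
From mathcomp Require Import measurable_realfun ring lra.

Set Implicit Arguments.
Unset Strict Implicit.
Unset Printing Implicit Defensive.

Import Order.TTheory GRing.Theory Num.Theory.
Import numFieldNormedType.Exports.

Local Open Scope classical_set_scope.
Local Open Scope ring_scope.
Local Open Scope complex_scope.

(** Write L = |t|^(1/b) + |x|, rho = (L / |t|)^(1/(b-1)) and N = L rho, so that
    |t| rho^b = N.  The substitution xi = rho eta turns each half of the
    integral into rho^(alpha+1) times an integral of the form
      J = int_0^oo cos (N (eta^b + w eta) + theta) eta^alpha d eta,
    where N >= 1, |w| <= 1, and |w| >= 1/2 as soon as N >= 4 (for if |w| < 1/2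
    then |t|^(1/b) makes up most of L, which keeps N bounded).  The choice
    theta = 0 gives the real part and theta = - pi/2 the imaginary part, and
    changing the signs of t, x and theta together changes nothing, so that t
    may be taken positive.  In these variables both cases of the claim say
      |J| <= C N^(-m),  m = min (1/2, alpha + 1):
    the exponent alpha + 1 is the price of the singular point eta = 0, the
    exponent 1/2 that of a stationary point of the phase, and the two cases of
    the statement tell which of them is smaller (rate_rescaled).

    The bound on J rests on one observation (oscillation_off_stationary):  on
    an interval where eta^alpha <= M |b eta^(b-1) + w| the integral is at most
    8 M / N.  Indeed, integrating by parts, it is controlled by the size and
    the total variation of g = eta^alpha / (N (b eta^(b-1) + w)), and the
    derivative of g changes sign at most once.  So it suffices to cover the
    half-line by intervals where g is suitably bounded and by short intervals
    where the absolute value of the integrand is integrated:  [0, 1/N] costs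
    N^(-(alpha+1)); an interval of length of order N^(-1/2) around the
    stationary point, if there is one, costs N^(-1/2); at distance N^(-1/2)
    from that point g is of order N^(-1/2), hence so is the integral; away from
    it g is at most of order N^(-1) + N^(-(alpha+1)); and for eta >= 1 the
    ratio eta^alpha / (b eta^(b-1) + w) is at most eta^(alpha-b+1), which both
    bounds the tail by 8 / N and, since alpha < b - 1, makes it converge
    (normalised_oscillation_bound, oscillation_tail_bound).

    All estimates are made on a primitive F of the integrand rather than on
    integrals:  scaling and reflection become the chain rule, and integration
    by parts becomes the mean value inequality for F - sin(phase) g.  The
    fundamental theorem of calculus supplies F, the singularity at 0 being
    integrable because alpha > -1; the Cauchy criterion then yields the
    improper integral with both ends free. *)

(** * Oscillating integrands with monotone amplitude *)

(** Both G - F and G + F are nondecreasing. *)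
Lemma mean_value_domination (R : realType) (F G f g : R -> R) (a c : R) :
  a <= c -> {within `[a, c], continuous F} -> {within `[a, c], continuous G} ->
  (forall y, y \in `]a, c[ -> is_derive y 1 F (f y)) ->
  (forall y, y \in `]a, c[ -> is_derive y 1 G (g y)) ->
  (forall y, y \in `]a, c[ -> `|f y| <= g y) ->
  `|F c - F a| <= G c - G a.
Proof.
rewrite le_eqVlt => /predU1P[<-|ac] cF cG dF dG fg.
  by rewrite !subrr normr0.
(* The signs s = 1 and s = -1 give the two inequalities. *)
have GF (s : R) : (forall y, y \in `]a, c[ -> 0 <= g y + s * f y) ->
    0 <= (G c - G a) + s * (F c - F a).
  move=> s0.
  have dH y : y \in `]a, c[ ->
      is_derive y 1 (fun z => G z + s * F z) (g y + s * f y).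
    move=> yac; have := dF y yac; have := dG y yac => dGy dFy.
    by apply: is_deriveD.
  have cH : {within `[a, c], continuous (fun z => G z + s * F z)}.
    move=> z; apply: cvgD; first exact: cG.
    by apply: cvgM; [exact: cvg_cst|exact: cF].
  have [z zac eH] := MVT ac dH cH.
  suff -> : (G c - G a) + s * (F c - F a) = (g z + s * f z) * (c - a).
    by rewrite mulr_ge0 ?s0// subr_ge0 ltW.
  by rewrite -eH; ring.
have fgN y : y \in `]a, c[ -> - g y <= f y <= g y.
  by move=> yac; rewrite -ler_norml; exact: fg.
have := GF 1; have := GF (-1).
rewrite ler_norml => H1 H2; apply/andP; split.
- have {H1} : 0 <= G c - G a + 1 * (F c - F a); last lra.
  by apply: H2 => y /fgN; lra.
- have {H2} : 0 <= G c - G a + -1 * (F c - F a); last lra.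
  by apply: H1 => y /fgN; lra.
Qed.

(** Integration by parts in disguise: D = F - sin(phi) g has derivative
    - sin(phi) dg, which the derivative of g dominates.  Hence F varies by at
    most the variation 2 M of g plus the two boundary terms. *)
Lemma oscillation_nondecreasing_amplitude (R : realType)
    (F phi g dphi dg : R -> R) (M a c : R) :
  a <= c -> {within `[a, c], continuous F} ->
  (forall y, y \in `]a, c[ -> is_derive y 1 F (cos (phi y) * (dphi y * g y))) ->
  (forall y, y \in `[a, c] -> is_derive y 1 phi (dphi y)) ->
  (forall y, y \in `[a, c] -> is_derive y 1 g (dg y)) ->
  (forall y, y \in `]a, c[ -> 0 <= dg y) ->
  `|g a| <= M -> `|g c| <= M -> `|F c - F a| <= 4 * M.
Proof.
move=> ac cF dF dp dgg dg0 gaM gcM.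
pose D y := F y - sin (phi y) * g y.
have sub y : y \in `]a, c[ -> y \in `[a, c] by exact: subset_itv_oo_cc.
have dS y : y \in `[a, c] ->
    is_derive y 1 (fun z => sin (phi z) * g z)
      (sin (phi y) * dg y + g y * (cos (phi y) * dphi y)).
  move=> yac; have := dp y yac; have := dgg y yac => dgy dpy.
  apply: is_deriveM.
have dD y : y \in `]a, c[ -> is_derive y 1 D (- (sin (phi y) * dg y)).
  move=> yac; have := dF y yac; have := dS y (sub y yac) => dSy dFy.
  by apply: (is_derive_eq (is_deriveB dFy dSy)); ring.
have cg : {within `[a, c], continuous g}.
  apply: derivable_within_continuous => y yac.
  by have := dgg y yac => dgy; exact: ex_derive.
have cD : {within `[a, c], continuous D}.
  move=> z; apply: cvgB; first exact: cF.
  move: z; apply: derivable_within_continuous => y yac.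
  by have := dS y yac => dSy; exact: ex_derive.
have := mean_value_domination ac cD cg dD (fun y yac => dgg y (sub y yac)).
move=> /(_ _)/wrap[y yac|].
  rewrite normrN normrM (ger0_norm (dg0 y yac)) ler_piMl ?dg0//.
  by rewrite ler_norml sin_geN1 sin_le1.
have bnd z : `|g z| <= M -> `|sin (phi z) * g z| <= M.
  move=> gzM; rewrite normrM; apply: le_trans gzM.
  by rewrite ler_piMl// ler_norml sin_geN1 sin_le1.
have := bnd _ gaM; have := bnd _ gcM; move: gaM gcM.
by rewrite /D !ler_norml; lra.
Qed.

(** Replacing F and g by their opposites exchanges the two monotonicity
    cases. *)
Lemma oscillation_monotone_amplitude (R : realType)
    (F phi g dphi dg : R -> R) (M a c : R) :
  a <= c -> {within `[a, c], continuous F} ->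
  (forall y, y \in `]a, c[ -> is_derive y 1 F (cos (phi y) * (dphi y * g y))) ->
  (forall y, y \in `[a, c] -> is_derive y 1 phi (dphi y)) ->
  (forall y, y \in `[a, c] -> is_derive y 1 g (dg y)) ->
  (forall y, y \in `]a, c[ -> 0 <= dg y) \/
    (forall y, y \in `]a, c[ -> dg y <= 0) ->
  `|g a| <= M -> `|g c| <= M -> `|F c - F a| <= 4 * M.
Proof.
move=> ac cF dF dp dgg [dg0|dg0] gaM gcM.
  exact: (oscillation_nondecreasing_amplitude ac cF dF dp dgg).
have -> : `|F c - F a| = `|(- F c) - (- F a)| by rewrite -normrN opprB opprK addrC.
have cN : {within `[a, c], continuous (fun y => - F y)}.
  by move=> z; apply: cvgN; exact: cF.
have dN y : y \in `]a, c[ ->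
    is_derive y 1 (fun z => - F z) (cos (phi y) * (dphi y * - g y)).
  by move=> yac; have := dF y yac => dFy; rewrite !mulrN; exact: is_deriveN.
have dgN y : y \in `[a, c] -> is_derive y 1 (fun z => - g z) (- dg y).
  by move=> yac; have := dgg y yac => dgy; exact: is_deriveN.
have dgN0 y : y \in `]a, c[ -> 0 <= - dg y by move=> yac; rewrite oppr_ge0 dg0.
rewrite -normrN in gaM; rewrite -normrN in gcM.
exact: (oscillation_nondecreasing_amplitude ac cN dN dp dgN dgN0 gaM gcM).
Qed.

(** * The phase N (y^b + w y) away from its stationary point *)

Section one_oscillating_half_line.
Variables (R : realType) (alpha : R) (q : nat).
Hypotheses (q0 : (0 < q)%N) (alpha1 : -1 < alpha) (alphaq : alpha < q%:R).

(** The degree b is written q.+1, so that q = b - 1 is the exponent in the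
    slope. *)
Definition normal_phase (N w theta y : R) : R :=
  N * (y ^+ q.+1 + w * y) + theta.

Definition normal_slope (w y : R) : R := q.+1%:R * y ^+ q + w.

Definition normal_integrand (N w theta y : R) : R :=
  cos (normal_phase N w theta y) * y `^ alpha.

(** Differentiability is required only in the open interval: at 0 the
    integrand is in general unbounded, and continuity of F is all that
    survives there. *)
Definition primitive_on (A : R) (f F : R -> R) : Prop :=
  (forall y, y \in `[0, A] -> {for y, continuous F}) /\
  (forall y, y \in `]0, A[ -> is_derive y 1 F (f y)).

Lemma primitive_on_subitv (A a c : R) (f F : R -> R) :
  primitive_on A f F -> 0 <= a -> c <= A ->
  {within `[a, c], continuous F} /\
  (forall y, y \in `]a, c[ -> is_derive y 1 F (f y)).
Proof.
move=> [cF dF] a0 cA; split.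
  apply: continuous_in_subspaceT => y; rewrite inE/= in_itv/= => /andP[ay yc].
  by apply: cF; rewrite in_itv/= (le_trans a0 ay) (le_trans yc cA).
move=> y; rewrite in_itv/= => /andP[ay yc]; apply: dF.
by rewrite in_itv/= (le_lt_trans a0 ay) (lt_le_trans yc cA).
Qed.

Lemma is_derive_pow (n : nat) (y : R) :
  is_derive y 1 (fun z : R => z ^+ n) (n%:R * y ^+ n.-1).
Proof.
apply: (is_derive_eq (derivableP (@exprn_derivable R n y 1))).
by rewrite exp_derive /GRing.scale/= mulr1.
Qed.

Lemma is_derive_normal_phase (N w theta y : R) :
  is_derive y 1 (normal_phase N w theta) (N * normal_slope w y).
Proof.
have dw := is_deriveZ w (is_derive_id y 1).
have dN := is_deriveZ N (is_deriveD (is_derive_pow q.+1 y) dw).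
apply: (is_derive_eq (is_deriveD dN (is_derive_cst theta y 1))).
by rewrite /normal_slope /GRing.scale/=; ring.
Qed.

(** The derivative is written with the nondecreasing function
    b (q - alpha) y^q - alpha w as its last factor, which is what makes its
    sign easy to follow. *)
Lemma is_derive_amplitude (N w y : R) : 0 < y -> N != 0 ->
  normal_slope w y != 0 ->
  is_derive y 1 (fun z => z `^ alpha / (N * normal_slope w z))
    (- (y `^ (alpha - 1) / (N * normal_slope w y ^+ 2) *
        (q.+1%:R * (q%:R - alpha) * y ^+ q - alpha * w))).
Proof.
move=> y0 N0 s0.
have dslope : is_derive y 1 (fun z => N * normal_slope w z)
    (N * (q.+1%:R * (q%:R * y ^+ q.-1))).
  have dq := is_deriveZ (q.+1%:R : R) (is_derive_pow q y).
  apply: (is_derive_eq (is_deriveZ N (is_deriveD dq (is_derive_cst w y 1)))).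
  by rewrite /GRing.scale/=; ring.
have Ns0 : N * normal_slope w y != 0 by rewrite mulf_neq0.
have dpow := is_derive1_powR alpha y0.
have dV := @is_deriveV R (fun z => N * normal_slope w z) y _ _ Ns0 dslope.
apply: (is_derive_eq (is_deriveM dpow dV)).
have -> : y `^ alpha = y `^ (alpha - 1) * y.
  rewrite -[X in _ * X]powRr1 ?ltW// -powRD ?subrK//.
  by rewrite (gt_eqF y0) implybT.
have yq : y ^+ q = y * y ^+ q.-1 by rewrite -exprS prednK.
rewrite /GRing.scale/= yq; move: s0; rewrite /normal_slope yq => s0; field.
by rewrite N0 andbT nat1r.
Qed.

(** Covers also the functions of constant sign, for which s is an endpoint
    and one of the two open intervals is empty. *)
Lemma nondecreasing_sign_split (k : R -> R) (a c : R) : a <= c ->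
  {within `[a, c], continuous k} ->
  {in `[a, c] &, {homo k : x y / x <= y}} ->
  exists s, [/\ a <= s <= c, forall y, y \in `]a, s[ -> k y <= 0 &
    forall y, y \in `]s, c[ -> 0 <= k y].
Proof.
move=> ac ck hk.
have aac : a \in `[a, c] by rewrite bound_itvE.
have cac : c \in `[a, c] by rewrite bound_itvE.
have [ka|ka] := leP 0 (k a).
  exists a; rewrite lexx ac; split => // y.
    by rewrite in_itv/= => /andP[/lt_trans/[apply]]; rewrite ltxx.
  move=> /subset_itv_oo_cc yac; apply: le_trans ka _.
  by apply: hk => //; have := yac; rewrite in_itv/= => /andP[].
have [kc|kc] := leP (k c) 0.
  exists c; rewrite lexx ac; split => // y.
    move=> /subset_itv_oo_cc yac; apply: le_trans kc.
    by apply: hk => //; have := yac; rewrite in_itv/= => /andP[].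
  by rewrite in_itv/= => /andP[/lt_trans/[apply]]; rewrite ltxx.
have [|s sac ks] := @IVT R k a c 0 ac ck.
  by rewrite ge_min le_max (ltW ka) (ltW kc) orbT.
have := sac; rewrite in_itv/= => /andP[aLs sLc].
exists s; rewrite aLs sLc; split => // y; rewrite in_itv/= => /andP[y1 y2].
  by rewrite -ks hk// ?ltW// in_itv/= (ltW y1) (le_trans (ltW y2) sLc).
by rewrite -ks hk// ?ltW// in_itv/= (ltW y2) (le_trans aLs (ltW y1)).
Qed.

(** The first-derivative test of van der Corput.  The amplitude
    g = y^alpha / (N (b y^q + w)) is bounded by M / N, and its derivative is
    a negative multiple of the nondecreasing function k below, so g increases
    and then decreases; each of the two pieces contributes 4 M / N.  Using
    monotonicity instead of a pointwise bound on g' avoids a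
    logarithmic loss when alpha = 0. *)
Lemma oscillation_off_stationary (N w theta A M a c : R) (F : R -> R) :
  0 < N -> primitive_on A (normal_integrand N w theta) F ->
  0 < a -> a <= c -> c <= A ->
  (forall y, a <= y <= c -> y `^ alpha <= M * `|normal_slope w y|) ->
  `|F c - F a| <= 8 * (M / N).
Proof.
move=> N0 FP a0 ac cA gM.
have slope0 y : a <= y <= c -> normal_slope w y != 0.
  move=> yac; apply/negP => /eqP s0; have := gM y yac.
  rewrite s0 normr0 mulr0 leNgt powR_gt0//.
  by case/andP: yac => ay _; exact: lt_le_trans ay.
pose g y := y `^ alpha / (N * normal_slope w y).
pose k y := q.+1%:R * (q%:R - alpha) * y ^+ q - alpha * w.
pose m y := y `^ (alpha - 1) / (N * normal_slope w y ^+ 2).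
have g_le y : a <= y <= c -> `|g y| <= M / N.
  move=> yac; rewrite /g normrM ger0_norm ?powR_ge0// normfV normrM (gtr0_norm N0).
  rewrite invfM mulrA ler_pdivrMr ?normr_gt0 ?slope0//.
  by rewrite mulrAC ler_wpM2r ?gM// invr_ge0 ltW.
have dg y : a <= y <= c -> is_derive y 1 g (- (m y * k y)).
  move=> yac; apply: is_derive_amplitude; last exact: slope0.
    by case/andP: yac => ay _; exact: lt_le_trans ay.
  by rewrite gt_eqF.
have m0 y : 0 <= m y.
  by rewrite divr_ge0 ?powR_ge0// mulr_ge0 ?sqr_ge0// ltW.
have cstk : 0 <= q.+1%:R * (q%:R - alpha) :> R.
  by rewrite mulr_ge0// subr_ge0 ltW.
have [||s [/andP[aLs sLc] ks1 ks2]] := @nondecreasing_sign_split k a c ac.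
- apply: derivable_within_continuous => y _.
  have dq := is_deriveZ (q.+1%:R * (q%:R - alpha) : R) (is_derive_pow q y).
  have := is_deriveB dq (is_derive_cst (alpha * w) y 1) => dk.
  exact: ex_derive.
- move=> u v; rewrite !in_itv/= => /andP[au _] /andP[av _] uv.
  rewrite lerB// ler_wpM2l// lerXn2r// nnegrE.
    by rewrite (le_trans (ltW a0)).
  by rewrite (le_trans (ltW a0)).
have piece u v : a <= u -> u <= v -> v <= c ->
    (forall y, y \in `]u, v[ -> 0 <= - (m y * k y)) \/
    (forall y, y \in `]u, v[ -> - (m y * k y) <= 0) ->
    `|F v - F u| <= 4 * (M / N).
  move=> au uv vc sgn.
  have [cF dF] := primitive_on_subitv FP (le_trans (ltW a0) au) (le_trans vc cA).
  have uvac y : y \in `[u, v] -> a <= y <= c.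
    by rewrite in_itv/= => /andP[uy yv]; rewrite (le_trans au uy) (le_trans yv vc).
  have dF' y : y \in `]u, v[ ->
      is_derive y 1 F (cos (normal_phase N w theta y) * (N * normal_slope w y * g y)).
    move=> yuv; have yac := uvac y (subset_itv_oo_cc yuv).
    have -> : N * normal_slope w y * g y = y `^ alpha.
      rewrite /g mulrCA divff ?mulr1//.
      by rewrite mulf_neq0 ?slope0// gt_eqF.
    exact: dF.
  have dphi y : y \in `[u, v] ->
      is_derive y 1 (normal_phase N w theta) (N * normal_slope w y).
    by move=> _; exact: is_derive_normal_phase.
  have dg' y : y \in `[u, v] -> is_derive y 1 g (- (m y * k y)).
    by move=> /uvac; exact: dg.
  have gu : `|g u| <= M / N by apply: g_le; rewrite au (le_trans uv).
  have gv : `|g v| <= M / N by apply: g_le; rewrite vc andbT (le_trans au).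
  exact: (oscillation_monotone_amplitude uv cF dF' dphi dg' sgn gu gv).
have H1 : `|F s - F a| <= 4 * (M / N).
  apply: piece => //; left => y yas.
  by rewrite -mulrN mulr_ge0// oppr_ge0 ks1.
have H2 : `|F c - F s| <= 4 * (M / N).
  apply: piece => //; right => y ysc.
  by rewrite oppr_le0 mulr_ge0// ks2.
have -> : F c - F a = (F c - F s) + (F s - F a) by ring.
apply: le_trans (ler_normD _ _) _; lra.
Qed.

(** Compares F with the primitive of y^alpha.  The interval may start at 0,
    where that primitive is only continuous. *)
Lemma oscillation_trivial_bound (N w theta A a c : R) (F : R -> R) :
  primitive_on A (normal_integrand N w theta) F ->
  0 <= a -> a <= c -> c <= A ->
  `|F c - F a| <= (c `^ (alpha + 1) - a `^ (alpha + 1)) / (alpha + 1).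
Proof.
move=> FP a0 ac cA.
have [cF dF] := primitive_on_subitv FP a0 cA.
have al0 : 0 < alpha + 1 by rewrite -ltrBlDr sub0r.
rewrite mulrBl; have [aEc|acne] := eqVneq a c.
  by rewrite aEc !subrr normr0.
have {acne}ac' : a < c by rewrite lt_neqAle acne.
apply: (@mean_value_domination R F (fun y => y `^ (alpha + 1) / (alpha + 1))
  (normal_integrand N w theta) (fun y => y `^ alpha) a c ac cF).
- have dpow (y : R) : 0 < y -> derivable (fun z : R => z `^ (alpha + 1)) y 1.
    by move=> y0; have := is_derive1_powR (alpha + 1) y0 => dp; exact: ex_derive.
  have cpow (y : R) : 0 < y -> {for y, continuous (fun z : R => z `^ (alpha + 1))}.
    by move=> y0; exact/differentiable_continuous/derivable1_diffP/dpow.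
  suff cP : {within `[a, c], continuous (fun y : R => y `^ (alpha + 1))}.
    by move=> z; apply: cvgM; [exact: cP|exact: cvg_cst].
  have [a0'|ane0] := eqVneq a 0; last first.
    apply: derivable_within_continuous => y; rewrite in_itv/= => /andP[ay _].
    by apply: dpow; apply: lt_le_trans ay; rewrite lt_neqAle eq_sym ane0.
  have c0 : 0 < c by rewrite -a0'.
  rewrite a0'; apply/(continuous_within_itvP _ c0); split.
  + by move=> y; rewrite in_itv/= => /andP[y0 _]; exact: cpow.
  + by rewrite powR0 ?gt_eqF//; exact: powR_cvg0.
  + by apply: cvg_at_left_filter; exact: cpow.
- move=> y; rewrite in_itv/= => /andP[ay yc].
  have y0 : 0 < y by exact: le_lt_trans ay.
  have dp := is_derive1_powR (alpha + 1) y0.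
  apply: (is_derive_eq (is_deriveM dp (is_derive_cst (alpha + 1)^-1 y 1))).
  by rewrite /GRing.scale/= addrK; field; rewrite gt_eqF.
- move=> y _; rewrite /normal_integrand normrM (ger0_norm (powR_ge0 _ _)).
  by rewrite ler_piMl ?powR_ge0// ler_norml cos_geN1 cos_le1.
Qed.

End one_oscillating_half_line.

(** * Elementary bounds on the slope and on powers *)

Section uniform_bound.
Variables (R : realType) (alpha : R) (q : nat).
Hypotheses (q0 : (0 < q)%N) (alpha1 : -1 < alpha) (alphaq : alpha < q%:R).

Lemma powRD_gt0 (x r s : R) : 0 < x -> x `^ (r + s) = x `^ r * x `^ s.
Proof. by move=> x0; rewrite powRD// (gt_eqF x0) implybT. Qed.

Lemma powR_nonincreasing (r x y : R) : r <= 0 -> 0 < x -> x <= y ->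
  y `^ r <= x `^ r.
Proof.
move=> r0 x0 xy; rewrite -[r]opprK !(powRN _ (- r)).
rewrite lef_pV2 ?posrE ?powR_gt0// ?(lt_le_trans x0)//.
by rewrite ge0_ler_powR ?nnegrE ?oppr_ge0// ltW// (lt_le_trans x0).
Qed.

(** The power is monotone, so its largest value on [l, 1] is reached at one
    of the ends. *)
Lemma powR_le1D (l y : R) : 0 < l -> l <= y -> y <= 1 ->
  y `^ alpha <= 1 + l `^ alpha.
Proof.
move=> l0 ly y1; have y0 := lt_le_trans l0 ly.
have [al0|al0] := leP 0 alpha.
  have : y `^ alpha <= y `^ 0 by rewrite ger_powR// y0.
  by rewrite powRr0; have := powR_ge0 l alpha; lra.
by have := powR_nonincreasing (ltW al0) l0 ly; lra.
Qed.

Lemma powR_le_exp (y : R) : 1 <= y -> y `^ alpha <= y ^+ q.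
Proof.
move=> y1; rewrite -powR_mulrn ?(le_trans _ y1)//.
by rewrite ler_powR// ltW.
Qed.

Lemma oscillation_length_bound (N w theta A K a c : R) (F : R -> R) :
  primitive_on A (normal_integrand alpha q N w theta) F ->
  0 <= a -> a <= c -> c <= A ->
  (forall y, a < y < c -> y `^ alpha <= K) ->
  `|F c - F a| <= K * (c - a).
Proof.
move=> FP a0 ac cA yK; rewrite mulrBr.
have [cF dF] := primitive_on_subitv FP a0 cA.
have dK (y : R) : is_derive y 1 (fun z : R => K * z) K.
  apply: (is_derive_eq (is_deriveZ K (is_derive_id y 1))).
  by rewrite /GRing.scale/= mulr1.
apply: (@mean_value_domination R F (fun y => K * y)
  (normal_integrand alpha q N w theta) (fun=> K) a c ac cF).
- apply: derivable_within_continuous => y _.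
  by have := dK y => dKy; exact: ex_derive.
- move=> y; rewrite in_itv/= => /yK; apply: le_trans.
  rewrite /normal_integrand normrM (ger0_norm (powR_ge0 _ _)).
  by rewrite ler_piMl ?powR_ge0// ler_norml cos_geN1 cos_le1.
Qed.

Lemma normal_slope_ge_exp (w y : R) : `|w| <= 1 -> 1 <= y ->
  y ^+ q <= normal_slope q w y.
Proof.
move=> w1 y1; rewrite /normal_slope -natr1 mulrDl mul1r.
have yq1 : 1 <= y ^+ q by rewrite exprn_ege1.
have q1 : 1 <= q%:R :> R by rewrite ler1n.
have : 1 <= q%:R * y ^+ q by exact: mulr_ege1.
by move: w1; rewrite ler_norml => /andP[w1 _]; lra.
Qed.

(** As alpha < q, the ratio y^alpha / y^q is nonincreasing, and the slope
    dominates y^q beyond 1. *)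
Lemma oscillation_tail_bound (N w theta A a c : R) (F : R -> R) :
  0 < N -> `|w| <= 1 ->
  primitive_on A (normal_integrand alpha q N w theta) F ->
  1 <= a -> a <= c -> c <= A ->
  `|F c - F a| <= 8 * (a `^ (alpha - q%:R) / N).
Proof.
move=> N0 w1 FP a1 ac cA; have a0 : 0 < a by exact: lt_le_trans a1.
apply: (oscillation_off_stationary q0 alphaq N0 FP) => // y /andP[ay yc].
have y1 := le_trans a1 ay; have y0 : 0 < y by exact: lt_le_trans y1.
have -> : y `^ alpha = y `^ (alpha - q%:R) * y `^ q%:R.
  by rewrite -powRD_gt0// subrK.
rewrite ler_pM ?powR_ge0//.
  by rewrite powR_nonincreasing// subr_le0 ltW.
rewrite powR_mulrn ?(ltW y0)//; apply: le_trans (ler_norm _).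
exact: normal_slope_ge_exp.
Qed.

(** In x^(n+1) - y^(n+1) = x (x^n - y^n) + y^n (x - y) the two terms on the
    right have the same sign. *)
Lemma ler_distXS (n : nat) (x y : R) : 0 <= x -> 0 <= y ->
  y ^+ n * `|x - y| <= `|x ^+ n.+1 - y ^+ n.+1|.
Proof.
move=> x0 y0.
have E : x ^+ n.+1 - y ^+ n.+1 = x * (x ^+ n - y ^+ n) + y ^+ n * (x - y).
  by rewrite !exprS; ring.
have [xy|/ltW yx] := leP x y.
  have xyn : x ^+ n <= y ^+ n by rewrite lerXn2r ?nnegrE.
  rewrite -normrN opprB [leRHS]distrC !ger0_norm ?subr_ge0//; last first.
    by rewrite lerXn2r ?nnegrE.
  have : 0 <= x * (y ^+ n - x ^+ n) by rewrite mulr_ge0 ?subr_ge0.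
  by move: E; lra.
have xyn : y ^+ n <= x ^+ n by rewrite lerXn2r ?nnegrE.
rewrite !ger0_norm ?subr_ge0//; last by rewrite lerXn2r ?nnegrE.
have : 0 <= x * (x ^+ n - y ^+ n) by rewrite mulr_ge0 ?subr_ge0.
by move: E; lra.
Qed.

(** The phase with coefficient w = - v is stationary at
    e = (v / b)^(1/q).  There q may equal 1 or be large, but e^(q-1) >= e^q
    >= 1 / (2 b) in all cases, which gives a lower bound on the slope that is
    linear in the distance to e. *)
Lemma stationary_point (v : R) : 1 / 2 <= v <= 1 ->
  exists2 e : R, 1 / (2 * q.+1%:R) <= e <= 1 &
    (forall y, 0 <= y -> `|y - e| / 2 <= `|normal_slope q (- v) y|).
Proof.
move=> /andP[v1 v2].
have b0 : 0 < q.+1%:R :> R by rewrite ltr0n.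
have vb0 : 0 < v / q.+1%:R by rewrite divr_gt0//; lra.
have qn0 : q%:R != 0 :> R by rewrite pnatr_eq0 -lt0n.
pose e : R := (v / q.+1%:R) `^ q%:R^-1.
have e0 : 0 < e by rewrite powR_gt0.
have eq : e ^+ q = v / q.+1%:R.
  by rewrite -powR_mulrn ?ltW// /e -powRrM mulVf// powRr1// ltW.
have e1 : e <= 1.
  rewrite leNgt; apply/negP => e1.
  have : 1 < e ^+ q by rewrite exprn_egt1// -lt0n.
  rewrite eq ltr_pdivlMr// mul1r => /lt_le_trans/(_ v2).
  by rewrite ltrn1.
have eq1 : 1 / (2 * q.+1%:R) <= e ^+ q.
  by rewrite eq invfM mulrA ler_wpM2r// invr_ge0 ltW.
have eqS : e ^+ q = e ^+ q.-1 * e by rewrite -exprSr prednK.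
have eqe : e ^+ q <= e ^+ q.-1 * 1.
  by rewrite eqS ler_wpM2l// exprn_ge0 ?(ltW e0).
exists e.
  rewrite e1 andbT (le_trans eq1)//.
  by rewrite eqS ler_piMl ?exprn_ile1 ?(ltW e0).
move=> y y0.
have -> : normal_slope q (- v) y = q.+1%:R * (y ^+ q - e ^+ q).
  by rewrite eq /normal_slope mulrBr mulrCA divff ?mulr1// gt_eqF.
rewrite normrM (ger0_norm (ltW b0)).
have := ler_distXS q.-1 y0 (ltW e0); rewrite prednK// => H.
apply: le_trans (ler_wpM2l (ltW b0) H).
rewrite mulrA [leLHS]mulrC ler_wpM2r//.
have := le_trans eq1 eqe; rewrite mulr1 ler_pdivrMr ?mulr_gt0//.
by move: (e ^+ q.-1) => z; lra.
Qed.

(** The worse of the contributions of the stationary point, 1/2, and of the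
    singular point 0, alpha + 1. *)
Definition decay : R := Num.min (1 / 2) (alpha + 1).

Lemma decay_bounds (N : R) : 1 <= N ->
  [/\ 1 / N <= N `^ (- decay), N `^ (- (1 / 2)) <= N `^ (- decay) &
     N `^ (- (alpha + 1)) <= N `^ (- decay)].
Proof.
move=> N1; have d1 : decay <= 1 / 2 by rewrite /decay ge_min lexx.
have d2 : decay <= alpha + 1 by rewrite /decay ge_min lexx orbT.
split; last 2 first.
- by rewrite ler_powR// lerN2.
- by rewrite ler_powR// lerN2.
rewrite div1r -powR_inv1 ?(le_trans _ N1)// ler_powR// lerN2.
by apply: le_trans d1 _; lra.
Qed.

End uniform_bound.

(** * The uniform bound in normalised variables *)

Section normalised_bound.
Variables (R : realType) (alpha : R) (q : nat).
Hypotheses (q0 : (0 < q)%N) (alpha1 : -1 < alpha) (alphaq : alpha < q%:R).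

Local Notation B := (q.+1%:R : R).
Local Notation r N := (N `^ (- decay alpha)).

Let B2 : 2 <= B. Proof. by rewrite ler_nat. Qed.

Local Ltac lin := clear - q0 alpha1 alphaq B2; lra.

Lemma powR_le_const (y : R) : 1 / (4 * B) <= y -> y <= 1 ->
  y `^ alpha <= 1 + 4 * B.
Proof.
move=> yl y1; have l0 : 0 < 1 / (4 * B) by rewrite divr_gt0// mulr_gt0.
apply: (le_trans (powR_le1D alpha l0 yl y1)); rewrite lerD2l.
apply: (@le_trans _ _ ((1 / (4 * B)) `^ (-1))).
  rewrite ger_powR ?(ltW alpha1)// l0 ler_pdivrMr ?mulr_gt0// mul1r.
  by move: B2; lra.
by rewrite powR_inv1 ?(ltW l0)// div1r invrK.
Qed.

(** The amplitude is controlled in two situations: where the slope is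
    bounded below, the power y^alpha costs at most 1 + N^(-alpha) because
    y >= 1/N; at distance at least of order N^(-1/2) from the stationary
    point, y is bounded below and the inverse slope costs N^(1/2).  A single
    bound for both lets oscillation_off_stationary run across the border
    between the two regions. *)
Lemma amplitude_bound (N w y : R) : 4 * B <= N -> `|w| <= 1 -> 1 / N <= y ->
  1 / (8 * B) <= `|normal_slope q w y| \/
    1 / (4 * B) <= y /\ N `^ (- (1 / 2)) / (8 * B) <= `|normal_slope q w y| ->
  y `^ alpha <=
    64 * B ^+ 2 * (1 + N `^ (- alpha) + N `^ (1 / 2)) * `|normal_slope q w y|.
Proof.
move=> BN w1 Ny sl; set s := `|normal_slope q w y| in sl *.
have N0 : 0 < N by move: B2 BN; lra.
have y0 : 0 < y by apply: lt_le_trans Ny; rewrite divr_gt0.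
have s0 : 0 <= s by exact: normr_ge0.
have h1 : 0 <= N `^ (- alpha) by exact: powR_ge0.
have h2 : 0 < N `^ (1 / 2) by exact: powR_gt0.
have [y1|y1] := leP 1 y.
  apply: (le_trans (powR_le_exp alphaq y1)).
  apply: (le_trans (normal_slope_ge_exp q0 w1 y1)).
  apply: (le_trans (ler_norm _)); rewrite -/s ler_peMl//.
  rewrite mulr_ege1//; last by move: h1 h2; lra.
  by rewrite mulr_ege1// ?exprn_ege1//; move: B2; lra.
have -> : 64 * B ^+ 2 * (1 + N `^ (- alpha) + N `^ (1 / 2)) * s =
    (8 * B) * ((8 * B) * s) * (1 + N `^ (- alpha) + N `^ (1 / 2)) by ring.
case: sl => [sl|[yl sl]].
  have : y `^ alpha <= 1 + (1 / N) `^ alpha.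
    by apply: powR_le1D => //; [rewrite divr_gt0|exact: ltW].
  rewrite div1r -powR_inv1 ?(ltW N0)// -powRrM mulN1r => yN.
  have : 1 <= 8 * B * s.
    by move: sl; rewrite ler_pdivrMr ?mulr_gt0// mulrC.
  move: (8 * B * s) B2 => z; move: B => b b2 z1.
  apply: (@le_trans _ _ (1 + N `^ (- alpha) + N `^ (1 / 2))).
    by move: yN h2; lra.
  rewrite ler_peMl//; first by move: h1 h2; lra.
  by rewrite mulr_ege1//; move: b2; lra.
have := powR_le_const yl (ltW y1).
have : 1 <= 8 * B * s * N `^ (1 / 2).
  move: sl; rewrite powRN ler_pdivrMr ?mulr_gt0// -div1r ler_pdivrMr//.
  by rewrite [s * _]mulrC.
have : 0 <= 8 * B * s by rewrite !mulr_ge0.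
move: (8 * B * s) (N `^ (1 / 2)) (N `^ (- alpha)) h2 h1 B2 => z n m.
move: B (y `^ alpha) => b p n0 m0 b2 z0 zn pb.
apply: (@le_trans _ _ (8 * b * (z * n))).
  apply: (le_trans pb); apply: (@le_trans _ _ (8 * b * 1)); first by lra.
  by rewrite ler_wpM2l//; lra.
rewrite mulrA ler_wpM2l ?mulr_ge0//; first by lra.
by lra.
Qed.

(** The three terms become 1 / N, N^(-(alpha+1)) and N^(-1/2) after division
    by N. *)
Lemma amplitude_decay (N : R) : 1 <= N ->
  64 * B ^+ 2 * (1 + N `^ (- alpha) + N `^ (1 / 2)) / N <= 192 * B ^+ 2 * r N.
Proof.
move=> N1; have N0 : 0 < N by exact: lt_le_trans N1.
have [d1 d2 d3] := decay_bounds alpha N1.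
have -> : 192 * B ^+ 2 * r N = 64 * B ^+ 2 * (3 * r N) by ring.
rewrite -mulrA ler_wpM2l ?mulr_ge0 ?exprn_ge0//.
have -> : (1 + N `^ (- alpha) + N `^ (1 / 2)) / N =
    1 / N + N `^ (- (alpha + 1)) + N `^ (- (1 / 2)).
  rewrite !mulrDl -powR_inv1 ?(ltW N0)// -!powRD_gt0//.
  by congr (_ + _ `^ _ + _ `^ _); lra.
by move: d1 d2 d3; lra.
Qed.

(** A sum of the costs of all the pieces of the half-line, large enough for
    each of the three configurations (N bounded, no stationary point, one
    stationary point). *)
Definition normal_constant : R :=
  (4 * B + 1) / (alpha + 1) + 4 * B + 2 ^+ q + 32 * B + 2 * (1536 * B ^+ 2).

Lemma normal_constant_gt0 : 0 < normal_constant.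
Proof.
have al0 : 0 < alpha + 1 by rewrite -ltrBlDr sub0r.
have h1 : 0 < (4 * B + 1) / (alpha + 1).
  by rewrite divr_gt0//; move: B2; lra.
have h2 : 0 < 2 ^+ q :> R by rewrite exprn_gt0.
have h3 : 0 <= B ^+ 2 by rewrite exprn_ge0.
by rewrite /normal_constant; move: h1 h2 h3 B2; lra.
Qed.

(** For bounded N there is nothing to gain on [0, 1].  For large N, the cost
    of [0, 1/N] is N^(-(alpha+1)).  If w >= 0 the slope is at least 1/2 and
    the rest is far from stationary.  If w < 0 the stationary point e lies in
    [1 / (2 b), 1], and an interval of half-length d = e N^(-1/2) / 2 around
    it is removed and estimated by its length. *)
Lemma normalised_oscillation_bound (N w theta A : R) (F : R -> R) :
  1 <= N -> `|w| <= 1 -> (4 <= N -> 1 / 2 <= `|w|) -> 2 <= A ->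
  primitive_on A (normal_integrand alpha q N w theta) F ->
  `|F A - F 0| <= normal_constant * r N.
Proof.
move=> N1 w1 wN A2 FP; have N0 : 0 < N by exact: lt_le_trans N1.
have al0 : 0 < alpha + 1 by rewrite -ltrBlDr sub0r.
have [d1 d2 d3] := decay_bounds alpha N1.
have r0 : 0 < r N by rewrite powR_gt0.
have B0 : 0 < B by rewrite ltr0n.
have BB0 : 0 < B ^+ 2 by rewrite exprn_gt0.
have q20 : 0 < 2 ^+ q :> R by rewrite exprn_gt0.
have start c : 0 < c -> c <= A -> `|F c - F 0| <= c `^ (alpha + 1) / (alpha + 1).
  move=> c0 cA; have := oscillation_trivial_bound alpha1 FP (lexx 0) (ltW c0) cA.
  by rewrite powR0 ?subr0// gt_eqF.
have ia0 : 0 < (alpha + 1)^-1 by rewrite invr_gt0.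
have p1 : 0 < 2 ^+ q * r N by rewrite mulr_gt0.
have p2 : 0 < B ^+ 2 * r N by rewrite mulr_gt0.
have p3 : 2 * r N <= B * r N by rewrite ler_wpM2r ?(ltW r0).
have p4 : 0 < r N / (alpha + 1) by rewrite mulr_gt0.
have p5 : 0 < B / (alpha + 1) * r N by rewrite !mulr_gt0.
have constE : normal_constant * r N = 4 * (B / (alpha + 1) * r N) +
    r N / (alpha + 1) + 36 * (B * r N) + 2 ^+ q * r N + 3072 * (B ^+ 2 * r N).
  by rewrite /normal_constant; ring.
have A1 : 1 <= A by move: A2; lin.
have iNA : 1 / N <= A.
  by rewrite ler_pdivrMr// (le_trans N1)// ler_peMl ?(ltW N0).
have [NB|BN] := ltP N (4 * B).
  have h1 : `|F 1 - F 0| <= (alpha + 1)^-1.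
    by have := start 1 ltr01 A1; rewrite powR1 div1r.
  have h2 : `|F A - F 1| <= 8 * (1 `^ (alpha - q%:R) / N).
    exact: (oscillation_tail_bound q0 alphaq N0 w1 FP (lexx 1) A1 (lexx A)).
  rewrite powR1 in h2.
  have r4 : 1 <= 4 * B * r N.
    apply: (@le_trans _ _ (4 * B * (1 / N))).
      by rewrite mulrA mulr1 ler_pdivlMr// mul1r ltW.
    by rewrite ler_wpM2l// mulr_ge0// ltW.
  have -> : F A - F 0 = (F A - F 1) + (F 1 - F 0) by ring.
  apply: (le_trans (ler_normD _ _)); rewrite constE.
  have h3 : (alpha + 1)^-1 <= 4 * (B / (alpha + 1) * r N).
    have -> : 4 * (B / (alpha + 1) * r N) = (4 * B * r N) / (alpha + 1) by ring.
    by rewrite ler_peMl ?(ltW ia0).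
  by move: d1 h1 h2 h3 p1 p2 p3 p4 p5 r0; lin.
pose S := 64 * B ^+ 2 * (1 + N `^ (- alpha) + N `^ (1 / 2)).
(* S bounds the ratio of y^alpha to the slope in every region off the
   stationary point. *)
have far a c : 1 / N <= a -> a <= c -> c <= A ->
    (forall y, a <= y <= c -> 1 / (8 * B) <= `|normal_slope q w y| \/
      1 / (4 * B) <= y /\ N `^ (- (1 / 2)) / (8 * B) <= `|normal_slope q w y|) ->
    `|F c - F a| <= 1536 * B ^+ 2 * r N.
  move=> Na ac cA sl; have a0 : 0 < a by apply: lt_le_trans Na; rewrite divr_gt0.
  apply: (@le_trans _ _ (8 * (S / N))).
    apply: (oscillation_off_stationary q0 alphaq N0 FP a0 ac cA) => y yac.
    apply: amplitude_bound => //; last exact: sl.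
    by case/andP: yac => ay _; exact: le_trans ay.
  by have := amplitude_decay N1; rewrite -/S; lin.
have h0 : `|F (1 / N) - F 0| <= r N / (alpha + 1).
  apply: (le_trans (start _ _ _)).
  - by rewrite divr_gt0.
  - exact: iNA.
  - rewrite ler_wpM2r ?(ltW ia0)//.
    by rewrite div1r -powR_inv1 ?(ltW N0)// -powRrM mulN1r.
have N4 : 4 <= N by move: BN B2; lin.
have {wN} := wN N4.
have [w0|w0] := leP 0 w.
  rewrite ger0_norm// => w2.
  have h1 : `|F A - F (1 / N)| <= 1536 * B ^+ 2 * r N.
    apply: far => //.
    move=> y /andP[Ny _]; left.
    have y0 : 0 <= y by apply: le_trans Ny; rewrite divr_ge0// ltW.
    apply: (@le_trans _ _ (1 / 2)).
      by rewrite ler_pdivrMr ?mulr_gt0//; move: B2; lin.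
    apply: le_trans (ler_norm _); rewrite /normal_slope.
    have : 0 <= B * y ^+ q by rewrite mulr_ge0 ?exprn_ge0 ?(ltW B0).
    by move: w2; lin.
  have -> : F A - F 0 = (F A - F (1 / N)) + (F (1 / N) - F 0) by ring.
  apply: (le_trans (ler_normD _ _)).
  by rewrite constE; move: h0 h1 p1 p2 p3 p4 p5 r0; lin.
rewrite ltr0_norm// => w2.
have [|e /andP[e1 e2] slope_e] := @stationary_point R q q0 (- w).
  by rewrite w2 -ltr0_norm.
have [b [bE b0]] : exists b, b = B^-1 /\ 0 < b.
  by exists B^-1; rewrite invr_gt0.
have b8 : 1 / (8 * B) = b / 8 by rewrite invfM -bE; field.
have b4 : 1 / (4 * B) = b / 4 by rewrite invfM -bE; field.
have {}e1 : b / 2 <= e by rewrite (le_trans _ e1)// invfM mul1r mulrC bE.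
pose n := N `^ (- (1 / 2)).
have n0 : 0 < n by rewrite powR_gt0.
have n1 : n <= 1 by rewrite -(powRr0 N) ler_powR//; lra.
have en1 : e * n <= e by rewrite ler_piMr//; move: e1 b0; lin.
have en2 : e * n <= n by rewrite ler_piMl// ltW.
have en3 : b / 2 * n <= e * n by rewrite ler_wpM2r// ltW.
have Nb : 1 / N <= b / 4.
  by rewrite -b4 !div1r lef_pV2 ?posrE// mulr_gt0.
have {}slope_e y : 0 <= y -> `|y - e| / 2 <= `|normal_slope q w y|.
  by move=> y0; have := slope_e y y0; rewrite opprK.
have iN0 : 0 < 1 / N by rewrite divr_gt0.
(* With this d the removed interval stays inside [e / 2, 3 e / 2], away from
   0 and to the right of 1 / N. *)
pose d := e * n / 2.
have d0 : 0 < d.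
  by rewrite /d !mulr_gt0 ?invr_gt0//; apply: lt_le_trans e1; rewrite divr_gt0.
have sep y : b / 4 <= y -> d <= `|y - e| ->
    1 / (4 * B) <= y /\ N `^ (- (1 / 2)) / (8 * B) <= `|normal_slope q w y|.
  move=> yB yd; split; first by rewrite b4.
  have y0 : 0 <= y by move: yB b0; lin.
  apply: le_trans (slope_e y y0); rewrite -/n.
  have -> : n / (8 * B) = b / 2 * n / 4 by rewrite invfM -bE; field.
  by move: yd en3; rewrite /d; lin.
have h1 : `|F (e - d) - F (1 / N)| <= 1536 * B ^+ 2 * r N.
  apply: far => //.
  - by move: Nb e1 en1; rewrite /d; lin.
  - by move: d0 e2 A2; lin.
  - move=> y /andP[Ny ye].
    have y0 : 0 <= y by move: Ny iN0; lin.
    have ye' : `|y - e| = e - y by rewrite distrC ger0_norm//; move: ye d0; lin.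
    (* Below e / 2 the slope is bounded below outright; above it, y is. *)
    have [ye2|ye2] := leP y (e / 2).
      left; apply: le_trans (slope_e y y0).
      by rewrite b8 ye'; move: ye2 e1; lin.
    by right; apply: sep; rewrite ?ye'; move: ye ye2 e1; lin.
have h3 : `|F A - F (e + d)| <= 1536 * B ^+ 2 * r N.
  apply: far => //.
  - by move: Nb e1 d0 b0; lin.
  - by move: en1 e2 A2; rewrite /d; lin.
  - move=> y /andP[ye yA]; right; apply: sep; first by move: ye e1 d0 b0; lin.
    by rewrite ger0_norm; move: ye d0; lin.
have h2 : `|F (e + d) - F (e - d)| <= (1 + 4 * B + 2 ^+ q) * (e + d - (e - d)).
  apply: (oscillation_length_bound FP).
  - by move: e1 en1 b0; rewrite /d; lin.
  - by move: d0; lin.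
  - by move: en1 e2 A2; rewrite /d; lin.
  - move=> y /andP[y1 y2]; have [yL1|yG1] := leP y 1.
      apply: (le_trans (powR_le_const _ yL1)); last by move: q20; lin.
      by rewrite b4; move: y1 e1 en1; rewrite /d; lin.
    apply: (le_trans (powR_le_exp alphaq (ltW yG1))).
    apply: (@le_trans _ _ (2 ^+ q)); last by move: B2; lin.
    rewrite lerXn2r ?nnegrE//; first by move: yG1; lin.
    by move: y2 en1 e2; rewrite /d; lin.
have {}h2 : `|F (e + d) - F (e - d)| <= r N + 4 * (B * r N) + 2 ^+ q * r N.
  apply: (le_trans h2).
  have -> : r N + 4 * (B * r N) + 2 ^+ q * r N = (1 + 4 * B + 2 ^+ q) * r N by ring.
  rewrite ler_wpM2l//; move: d2 en2; rewrite /d -/n; lin.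
have -> : F A - F 0 = (F A - F (e + d)) + ((F (e + d) - F (e - d)) +
    ((F (e - d) - F (1 / N)) + (F (1 / N) - F 0))) by ring.
apply: (le_trans (ler_normD _ _)).
have k1 := ler_normD (F (e + d) - F (e - d))
  ((F (e - d) - F (1 / N)) + (F (1 / N) - F 0)).
have k2 := ler_normD (F (e - d) - F (1 / N)) (F (1 / N) - F 0).
by rewrite constE; move: h0 h1 h2 h3 k1 k2 p1 p2 p3 p4 p5 r0; lin.
Qed.

End normalised_bound.

(** * Scaling back to arbitrary coefficients *)

Section scaling.
Variables (R : realType) (alpha : R) (q : nat).
Hypotheses (q0 : (0 < q)%N) (alpha1 : -1 < alpha) (alphaq : alpha < q%:R).

Definition half_integrand (t x theta y : R) : R :=
  cos (t * y ^+ q.+1 + x * y + theta) * y `^ alpha.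

Definition dispersive_rate (b : nat) (t x : R) : R :=
  if alpha <= - (1 / 2) then
    (`|t| `^ (1 / b%:R) + `|x|) `^ (- alpha - 1)
  else
    (`|t| `^ (1 / b%:R) + `|x|)
      `^ (1 / (b%:R - 1) * (alpha - b%:R / 2 + 1)) *
    `|t| `^ (1 / (b%:R - 1) * (- alpha - 1 / 2)).

Let qR0 : 0 < q%:R :> R. Proof. by rewrite ltr0n. Qed.

Lemma primitive_on_rescale (rho c A : R) (f F : R -> R) : 0 < rho ->
  primitive_on A f F ->
  primitive_on (A / rho) (fun y => c * rho * f (rho * y)) (fun y => c * F (rho * y)).
Proof.
move=> rho0 [cF dF]; split => y; rewrite in_itv/= => /andP[y0].
  rewrite ler_pdivlMr// mulrC => yA.
  apply: cvgM; first exact: cvg_cst.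
  apply: (@continuous_comp _ _ _ (fun z => rho * z) F).
    by apply: cvgM; [exact: cvg_cst|exact: cvg_id].
  by apply: cF; rewrite in_itv/= yA mulr_ge0// ltW.
rewrite ltr_pdivlMr// mulrC => yA.
have := dF (rho * y); rewrite in_itv/= yA mulr_gt0// => /(_ isT) dFy.
have dr := is_deriveZ rho (is_derive_id y 1).
apply: (is_derive_eq (is_deriveZ c (is_derive1_comp dFy dr))).
by rewrite /GRing.scale/=; ring.
Qed.

Section parameters.
Variables (t x : R).
Hypothesis t0 : 0 < t.

Let L : R := t `^ (1 / q.+1%:R) + `|x|.
Let rho : R := (L / t) `^ (1 / q%:R).
Let N : R := L * rho.

Let tb0 : 0 < t `^ (1 / q.+1%:R). Proof. by rewrite powR_gt0. Qed.
Let L0 : 0 < L. Proof. by rewrite ltr_pwDl. Qed.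
Let rho0 : 0 < rho. Proof. by rewrite powR_gt0// divr_gt0. Qed.
Let N0 : 0 < N. Proof. by rewrite mulr_gt0. Qed.

Let rho_exp : rho ^+ q = L / t.
Proof.
rewrite -powR_mulrn ?(ltW rho0)// /rho -powRrM div1r mulVf ?gt_eqF//.
by rewrite powRr1// divr_ge0// ltW.
Qed.

Let N_exp : N ^+ q = L ^+ q.+1 / t.
Proof. by rewrite exprMn rho_exp exprSr mulrA. Qed.

Let tb_exp : t `^ (1 / q.+1%:R) ^+ q.+1 = t.
Proof.
by rewrite -powR_mulrn ?(ltW tb0)// -powRrM div1r mulVf ?powRr1 ?(ltW t0).
Qed.

Let N1 : 1 <= N.
Proof.
rewrite leNgt; apply/negP => Nlt1.
have : N ^+ q < 1 by rewrite exprn_ilt1 ?(ltW N0)// -lt0n.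
rewrite N_exp ltr_pdivrMr// mul1r ltNge => /negP; apply.
rewrite -[leLHS]tb_exp lerXn2r ?nnegrE ?(ltW tb0) ?(ltW L0)//.
by rewrite /L lerDl.
Qed.

Let w1 : `|x / L| <= 1.
Proof.
rewrite normrM normfV (gtr0_norm L0) ler_pdivrMr// mul1r.
by rewrite /L lerDr ltW.
Qed.

Let w12 : 4 <= N -> 1 / 2 <= `|x / L|.
Proof.
move=> N4; rewrite normrM normfV (gtr0_norm L0) ler_pdivlMr// leNgt.
apply/negP => xL.
have Lt : L / 2 < t `^ (1 / q.+1%:R) by move: xL; rewrite /L; lra.
have : (L / 2) ^+ q.+1 < t.
  by rewrite -[ltRHS]tb_exp ltrXn2r// ?nnegrE ?(ltW tb0)// divr_ge0// ltW.
rewrite expr_div_n ltr_pdivrMr ?exprn_gt0// => H.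
(* N^q = L^b / t < 2^b <= 4^q would follow from |x| < L / 2. *)
have : 4 ^+ q <= N ^+ q by rewrite lerXn2r// nnegrE ltW.
rewrite N_exp ler_pdivlMr// mulrC => H'.
have : t * 4 ^+ q < t * 2 ^+ q.+1 by exact: le_lt_trans H.
rewrite ltr_pM2l// ltNge => /negP; apply.
have -> : 4 = 2 ^+ 2 :> R by ring.
by rewrite -exprM ler_eXn2l ?ltr1n// mul2n -addnn -add1n leq_add2r.
Qed.

(** The factor rho^(alpha+1) is divided out so that the rescaled function is
    a primitive of the normalised integrand itself. *)
Lemma rescaled_primitive (theta A : R) (F : R -> R) :
  primitive_on A (half_integrand t x theta) F ->
  primitive_on (A / rho) (normal_integrand alpha q N (x / L) theta)
    (fun y => rho `^ (- (alpha + 1)) * F (rho * y)).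
Proof.
move=> /(primitive_on_rescale (rho `^ (- (alpha + 1))) rho0) [cF dF]; split => // y yA.
apply: (is_derive_eq (dF y yA)).
have y0 : 0 < y by move: yA; rewrite in_itv/= => /andP[].
rewrite /half_integrand /normal_integrand /normal_phase.
rewrite powRM ?(ltW rho0) ?(ltW y0)//.
have -> : t * (rho * y) ^+ q.+1 + x * (rho * y) + theta =
    N * (y ^+ q.+1 + x / L * y) + theta.
  rewrite exprMn exprS rho_exp /N; congr (_ + _); field.
  by rewrite !gt_eqF.
rewrite [X in X * _ = _](_ : _ = rho `^ (- alpha)); last first.
  have {2}-> : rho = rho `^ 1 by rewrite powRr1// ltW.
  by rewrite -powRD_gt0//; congr (_ `^ _); ring.
by rewrite mulrCA [X in _ * X]mulrA -powRD_gt0// addNr powRr0 mul1r.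
Qed.

Let rescaled_bound (F : R -> R) (y z C : R) :
  `|rho `^ (- (alpha + 1)) * F (rho * (y / rho)) -
    rho `^ (- (alpha + 1)) * F (rho * (z / rho))| <= C ->
  `|F y - F z| <= C * rho `^ (alpha + 1).
Proof.
rewrite -mulrBr normrM (gtr0_norm (powR_gt0 _ rho0)) powRN.
rewrite mulrC ler_pdivrMr; last exact: powR_gt0.
by rewrite ![rho * _]mulrC !divfK ?gt_eqF.
Qed.

(** Both sides are monomials in L and t.  The threshold alpha = - 1/2
    between the two formulas is where alpha + 1 = 1/2. *)
Lemma rate_rescaled :
  N `^ (- decay alpha) * rho `^ (alpha + 1) = dispersive_rate q.+1 t x.
Proof.
have al0 : 0 < alpha + 1 by rewrite -ltrBlDr sub0r.
have qE : q.+1%:R - 1 = q%:R :> R by rewrite -natr1 addrK.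
rewrite /dispersive_rate (gtr0_norm t0) -/L /N powRM ?(ltW L0) ?(ltW rho0)//.
rewrite /decay; case: ifPn => [al|]; last rewrite -ltNge => al.
  rewrite min_r; last by move: al; lra.
  rewrite -mulrA -powRD_gt0// addNr powRr0 mulr1.
  by congr (_ `^ _); ring.
rewrite min_l; last by move: al; lra.
rewrite -mulrA -powRD_gt0// /rho -powRrM powRM ?(ltW L0) ?invr_ge0 ?(ltW t0)//.
rewrite mulrA -powRD_gt0//.
rewrite -(powR_inv1 (ltW t0)) -powRrM; congr (_ `^ _ * _ `^ _).
  by rewrite qE -natr1; field; rewrite gt_eqF.
by rewrite qE; field; rewrite gt_eqF.
Qed.

Let half_bound_pos (theta A : R) (F : R -> R) :
  2 * rho <= A -> primitive_on A (half_integrand t x theta) F ->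
  `|F A - F 0| <= normal_constant alpha q * dispersive_rate q.+1 t x.
Proof.
move=> rA FP; rewrite -rate_rescaled mulrA.
apply: rescaled_bound; rewrite mul0r.
apply: (normalised_oscillation_bound q0 alpha1 alphaq N1 w1 w12 _
  (rescaled_primitive FP)).
by rewrite ler_pdivlMr.
Qed.

Let half_tail_pos (theta A a c : R) (F : R -> R) :
  rho <= a -> a <= c -> c <= A -> primitive_on A (half_integrand t x theta) F ->
  `|F c - F a| <= 8 * (a / rho) `^ (alpha - q%:R) * rho `^ (alpha + 1).
Proof.
move=> ra ac cA FP; apply: rescaled_bound.
apply: (le_trans (oscillation_tail_bound q0 alphaq N0 w1 (rescaled_primitive FP)
  _ _ _)).
- by rewrite ler_pdivlMr// mul1r.
- by rewrite ler_wpM2r// invr_ge0 ltW.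
- by rewrite ler_wpM2r// invr_ge0 ltW.
- rewrite ler_wpM2l// ler_pdivrMr// ler_peMr// powR_ge0//.
Qed.

(** A0 serves two purposes: beyond 2 rho the normalised bound applies, and
    beyond rho Z the tail is smaller than eps, as Z solves
    8 rho^(alpha+1) Z^(alpha-q) = eps. *)
Lemma half_line_pos (theta eps : R) : 0 < eps -> exists2 A0, 0 < A0 &
  (forall A F, A0 <= A -> primitive_on A (half_integrand t x theta) F ->
    `|F A - F 0| <= normal_constant alpha q * dispersive_rate q.+1 t x) /\
  (forall a c A F, A0 <= a -> a <= c -> c <= A ->
    primitive_on A (half_integrand t x theta) F -> `|F c - F a| <= eps).
Proof.
move=> eps0.
pose K := 8 * rho `^ (alpha + 1).
have K0 : 0 < K by rewrite mulr_gt0// powR_gt0.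
have qa0 : 0 < q%:R - alpha by rewrite subr_gt0.
pose Z := (K / eps) `^ (q%:R - alpha)^-1.
have Z0 : 0 < Z by rewrite powR_gt0// divr_gt0.
exists (rho * (2 + Z)); first by rewrite mulr_gt0// addr_gt0.
split=> [A F A0 FP|a c A F A0 ac cA FP].
  apply: half_bound_pos FP; apply: le_trans A0.
  by rewrite mulrC ler_wpM2l ?(ltW rho0)// lerDl ltW.
have Za : Z <= a / rho.
  rewrite ler_pdivlMr// mulrC; apply: le_trans A0.
  by rewrite ler_wpM2l ?(ltW rho0)// lerDr.
apply: (le_trans (half_tail_pos _ ac cA FP)).
  apply: le_trans A0; rewrite ler_peMr ?(ltW rho0)//.
  by move: Z0; lra.
rewrite mulrAC -/K.
apply: (@le_trans _ _ (K * Z `^ (alpha - q%:R))).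
  rewrite ler_wpM2l ?(ltW K0)// powR_nonincreasing//.
  by rewrite subr_le0 ltW.
rewrite /Z -powRrM [X in _ `^ X](_ : _ = -1); last first.
  by field; rewrite gt_eqF.
rewrite powR_inv1; last by rewrite ltW// divr_gt0.
by rewrite invf_div mulrC divfK ?gt_eqF.
Qed.

End parameters.

(** The cosine is even, so t, x and theta may change sign together. *)
Lemma half_line (t x theta eps : R) : t != 0 -> 0 < eps -> exists2 A0, 0 < A0 &
  (forall A F, A0 <= A -> primitive_on A (half_integrand t x theta) F ->
    `|F A - F 0| <= normal_constant alpha q * dispersive_rate q.+1 t x) /\
  (forall a c A F, A0 <= a -> a <= c -> c <= A ->
    primitive_on A (half_integrand t x theta) F -> `|F c - F a| <= eps).
Proof.
move=> tn0 eps0; have [t0|t0] := ltP 0 t; first exact: half_line_pos.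
have nt0 : 0 < - t by rewrite oppr_gt0 lt_neqAle tn0.
have [A0 A00 [H1 H2]] := half_line_pos (- x) nt0 (- theta) eps0.
have E : half_integrand (- t) (- x) (- theta) = half_integrand t x theta.
  apply/funext => y; rewrite /half_integrand -cosN; congr (cos _ * _); ring.
have rE : dispersive_rate q.+1 (- t) (- x) = dispersive_rate q.+1 t x.
  by rewrite /dispersive_rate !normrN.
by exists A0 => //; split; rewrite -E -?rE.
Qed.

End scaling.

(** * Integrability and primitives on the line *)

Section integrals.
Variables (R : realType) (alpha : R) (q : nat).
Hypotheses (alpha1 : -1 < alpha).
Local Notation mu := (@lebesgue_measure R).

Definition line_integrand (t x theta xi : R) : R :=
  cos (t * xi ^+ q.+1 + x * xi + theta) * `|xi| `^ alpha.

Let al0 : 0 < alpha + 1. Proof. by rewrite -ltrBlDr sub0r. Qed.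

Lemma continuous_powR_norm (y : R) : y != 0 ->
  {for y, continuous (fun z : R => `|z| `^ alpha)}.
Proof.
move=> y0; apply: (@continuous_comp _ _ _ (fun z : R => `|z|) (fun z => z `^ alpha)).
  exact: norm_continuous.
apply/differentiable_continuous/derivable1_diffP.
have ny0 : 0 < `|y| by rewrite normr_gt0.
by have := is_derive1_powR alpha ny0 => dp; exact: ex_derive.
Qed.

Lemma integral_powR_norm (e K : R) : 0 < e -> e < K ->
  (\int[mu]_(y in `[e, K]) (`|y| `^ alpha)%:E <= (K `^ (alpha + 1) / (alpha + 1))%:E)%E.
Proof.
move=> e0 eK.
have dF (y : R) : 0 < y ->
    is_derive y 1 (fun z : R => z `^ (alpha + 1) / (alpha + 1)) (y `^ alpha).
  move=> y0; have dp := is_derive1_powR (alpha + 1) y0.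
  apply: (is_derive_eq (is_deriveM dp (is_derive_cst (alpha + 1)^-1 y 1))).
  by rewrite /GRing.scale/= addrK; field; rewrite gt_eqF.
have cF (y : R) : 0 < y ->
    {for y, continuous (fun z : R => z `^ (alpha + 1) / (alpha + 1))}.
  move=> y0; apply/differentiable_continuous/derivable1_diffP.
  by have := dF y y0 => dFy; exact: ex_derive.
rewrite (@continuous_FTC2 _ _ (fun z : R => z `^ (alpha + 1) / (alpha + 1)))//.
- rewrite -EFinB lee_fin gerDl oppr_le0.
  by rewrite divr_ge0 ?powR_ge0// ltW.
- apply: continuous_in_subspaceT => y; rewrite inE/= in_itv/= => /andP[ey _].
  by apply: continuous_powR_norm; rewrite gt_eqF// (lt_le_trans e0).
- split.
  + move=> y; rewrite in_itv/= => /andP[ey _].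
    by have := dF y (lt_trans e0 ey) => dFy; exact: ex_derive.
  + by apply: cvg_at_right_filter; exact: cF.
  + by apply: cvg_at_left_filter; apply: cF; exact: lt_trans eK.
- move=> y; rewrite in_itv/= => /andP[ey _].
  have y0 := lt_trans e0 ey; have dFy := dF y y0.
  by rewrite derive1E derive_val gtr0_norm.
Qed.

Lemma measurable_powR_norm : measurable_fun setT (fun y : R => `|y| `^ alpha).
Proof.
apply: (measurableT_comp (measurable_powR alpha)).
exact: normr_measurable.
Qed.

(** Monotone convergence over the sets e_n <= |y| <= K, on which the
    fundamental theorem of calculus bounds the integral by
    2 K^(alpha+1) / (alpha+1); the sets exhaust the interval up to the null
    set reduced to 0. *)
Lemma integrable_powR_norm (K : R) : 1 < K ->
  mu.-integrable `[- K, K] (EFin \o (fun y : R => `|y| `^ alpha)).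
Proof.
move=> K1.
have mf D : measurable_fun D (EFin \o (fun y : R => `|y| `^ alpha)).
  apply/measurable_EFinP; apply: measurable_funS measurable_powR_norm => //.
have meas0 : measurable [set 0 : R] by exact: measurable_set1.
apply/(@negligible_integrable _ _ _ mu `[- K, K] [set 0] _ meas0
  (measurable_itv _) (mf _) (lebesgue_measure_set1 0)).
(* Starting at 1/2 keeps every e n below K. *)
pose e (n : nat) : R := n.+2%:R^-1.
have e0 n : 0 < e n by rewrite invr_gt0.
have eK n : e n < K.
  by apply: lt_trans K1; rewrite invf_lt1// ltr1n.
pose E n : set R := `[- K, - e n] `|` `[e n, K].
have EK : `[- K, K] `\` [set 0] = \bigcup_n E n.
  apply/seteqP; split => y; rewrite /E /=.
    rewrite in_itv/= => -[/andP[Ky yK] /eqP y0].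
    have ny0 : 0 < `|y| by rewrite normr_gt0.
    have [n _ /(_ n (leqnn n)) /= ny] := near_infty_natSinv_lt (PosNum ny0).
    have {}ny : e n < `|y|.
      by apply: le_lt_trans ny; rewrite /e lef_pV2 ?posrE// ler_nat.
    exists n => //=; rewrite !in_itv/=.
    have [yp|yn] := ltP 0 y.
      by right; move: ny; rewrite gtr0_norm// yK andbT => /ltW.
    by left; move: ny; rewrite ler0_norm// Ky ltrNr/= => /ltW.
  move=> [n _] /=; rewrite !in_itv/= => -[|] /andP[h1 h2].
    split; first by apply/andP; split => //; move: (e0 n) h2 K1; lra.
    by move=> y0; move: h2; rewrite y0 oppr_ge0 leNgt e0.
  split; first by apply/andP; split => //; move: (e0 n) h1 K1; lra.
  by move=> y0; move: h1; rewrite y0 leNgt e0.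
apply/integrableP; split; first exact: mf.
have f0 (y : R) : (0 <= (`|y| `^ alpha)%:E)%E by rewrite lee_fin powR_ge0.
rewrite (@eq_integral _ _ _ mu _ (EFin \o (fun y : R => `|y| `^ alpha))); last first.
  by move=> y _; apply: gee0_abs; exact: f0.
rewrite EK.
apply: (@le_lt_trans _ _ (2 * (K `^ (alpha + 1) / (alpha + 1)))%:E); last first.
  exact: ltry.
have mE n : measurable (E n) by apply: measurableU; exact: measurable_itv.
have ndE : {homo E : n m / (n <= m)%N >-> (n <= m)%O}.
  move=> n m nm; apply/subsetPset => y; rewrite /E/= !in_itv/=.
  have emn : e m <= e n by rewrite /e lef_pV2 ?posrE// ler_nat.
  move=> [|] /andP[h1 h2]; [left|right].
    by rewrite h1/= (le_trans h2)// lerN2.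
  by rewrite h2 (le_trans emn).
have cv := @ge0_nondecreasing_set_cvg_integral _ (measurableTypeR R) R E
  (EFin \o (fun y : R => `|y| `^ alpha)) mu ndE mE (fun n => mf (E n))
  (fun n y _ => f0 y).
rewrite -(cvg_lim _ cv)//; apply: lime_le; first by apply: cvgP cv.
apply: nearW => n.
have dis : [disjoint (`[- K, - e n] : set R) & `[e n, K]].
  apply/disj_setPS => y /= []; rewrite !in_itv/= => /andP[_ h1] /andP[h2 _].
  have := e0 n; have := le_trans h2 h1; lra.
rewrite ge0_integral_setU//; last 2 first.
- exact: mf.
- by move=> y _; exact: f0.
rewrite mulr_natl mulr2n EFinD leeD//; last exact: integral_powR_norm.
rewrite integration_by_substitution_oppr; last 2 first.
- exact: ltW.
- apply: continuous_in_subspaceT => y; rewrite inE/= in_itv/= => /andP[_ ye].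
  by apply: continuous_powR_norm; rewrite lt_eqF// (le_lt_trans ye)// oppr_lt0.
under eq_integral do rewrite /= normrN.
exact: integral_powR_norm.
Qed.

Lemma continuous_line_phase (t x theta : R) :
  continuous (fun xi : R => cos (t * xi ^+ q.+1 + x * xi + theta)).
Proof.
move=> y; have d := is_derive_pow q.+1 y.
have dphi := is_deriveD (is_deriveD (is_deriveZ t d) (is_deriveZ x (is_derive_id y 1)))
  (is_derive_cst theta y 1).
apply: (@continuous_comp _ _ _ (fun xi : R => t * xi ^+ q.+1 + x * xi + theta) cos).
  apply/differentiable_continuous/derivable1_diffP.
  have : derivable (t *: (fun z : R => z ^+ q.+1) + x *: id + cst theta) y 1.
    exact: ex_derive.
  by [].
exact: continuous_cos.
Qed.

Lemma integrable_line_integrand (t x theta K : R) : 1 < K ->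
  mu.-integrable `[- K, K] (EFin \o line_integrand t x theta).
Proof.
move=> K1; apply: le_integrable (integrable_powR_norm K1) => //.
  apply/measurable_EFinP; apply: measurable_funM.
    apply: measurable_funTS; apply: continuous_measurable_fun.
    exact: continuous_line_phase.
  by apply: measurable_funTS; exact: measurable_powR_norm.
move=> y _ /=; rewrite lee_fin /line_integrand normrM.
by rewrite ler_piMl// ler_norml cos_geN1 cos_le1.
Qed.


Section primitive.
Variables (t x theta K : R).
Hypothesis K1 : 1 < K.
Local Notation f := (line_integrand t x theta).

Definition line_primitive (s : R) : R := \int[mu]_(y in `[- K, s]) f y.
Local Notation I := line_primitive.

Lemma line_primitive_continuous (s : R) : - K < s < K -> {for s, continuous I}.
Proof.
move=> sK; have KK : - K < K by move: K1; lra.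
have cI := parameterized_integral_continuous (ltW KK)
  (integrable_line_integrand t x theta K1).
by apply: (within_continuous_continuous KK cI); rewrite in_itv.
Qed.

Lemma line_primitive_derive (s : R) : - K < s < K -> s != 0 ->
  is_derive s 1 I (f s).
Proof.
move=> /andP[Ks sK] s0.
have cf : {for s, continuous f}.
  apply: cvgM; first exact: continuous_line_phase.
  exact: continuous_powR_norm.
have [dI eI] := continuous_FTC1_closed sK (integrable_line_integrand t x theta K1) Ks cf.
by have := derivableP dI; rewrite -derive1E eI.
Qed.

Lemma primitive_on_right (A : R) : A < K ->
  primitive_on A (half_integrand alpha q t x theta) I.
Proof.
move=> AK; split => y; rewrite in_itv/= => /andP[y0 yA].
  by apply: line_primitive_continuous; move: K1; lra.
have -> : half_integrand alpha q t x theta y = f y.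
  by rewrite /half_integrand /line_integrand gtr0_norm.
by apply: line_primitive_derive; [move: K1; lra|rewrite gt_eqF].
Qed.

(** The reflection y -> - y multiplies t by (-1)^b and x by -1, which leaves
    |t| and |x| unchanged. *)
Lemma primitive_on_left (A : R) : A < K ->
  primitive_on A (half_integrand alpha q (t * (-1) ^+ q.+1) (- x) theta)
    (fun s => - I (- s)).
Proof.
move=> AK; split => y; rewrite in_itv/= => /andP[y0 yA].
  apply: cvgN; apply: (@continuous_comp _ _ _ -%R I).
    by apply: cvgN; exact: cvg_id.
  by apply: line_primitive_continuous; move: K1; lra.
have -> : half_integrand alpha q (t * (-1) ^+ q.+1) (- x) theta y = f (- y).
  rewrite /half_integrand /line_integrand normrN gtr0_norm//.
  by congr (cos (_ + _) * _); rewrite mulNr mulrN -[- y]mulN1r exprMn mulrA.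
have dI : is_derive (- y) 1 I (f (- y)).
  by apply: line_primitive_derive; [move: K1; lra|rewrite lt_eqF// oppr_lt0].
have dN := is_deriveNid y (1 : R).
apply: (is_derive_eq (is_deriveN (is_derive1_comp dI dN))).
by rewrite mulrN1 opprK.
Qed.

Lemma line_integral_split (R1 R2 : R) : 0 <= R1 < K -> 0 <= R2 < K ->
  \int[mu]_(y in `[- R1, R2]) f y = (I R2 - I 0) + (- I (- R1) - - I (- 0)).
Proof.
move=> /andP[R10 R1K] /andP[R20 R2K].
have intK : mu.-integrable `[- K, R2] (EFin \o f).
  apply: integrableS (integrable_line_integrand t x theta K1) => //.
  by apply: subset_itvScc; rewrite bnd_simp// ltW.
have int1 : mu.-integrable `]- R1, R2] (EFin \o f).
  apply: integrableS intK => //.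
  by apply: subset_itv; rewrite bnd_simp// lerN2 ltW.
rewrite -Rintegral_itv_obnd_cbnd// -(Rintegral_itvB intK) ?bnd_simp//.
- by rewrite -/(I R2) -/(I (- R1)) oppr0; ring.
- by rewrite lerN2 ltW.
- by move: R10 R20; lra.
Qed.

End primitive.

End integrals.

(** * Convergence and size of the improper integral *)

Section improper.
Variables (R : realType) (alpha : R) (q : nat).
Hypotheses (q0 : (0 < q)%N) (alpha1 : -1 < alpha) (alphaq : alpha < q%:R).
Local Notation mu := (@lebesgue_measure R).

Lemma near_pinfty_pair (M : R) :
  \forall p \near (+oo%R : set_system R, +oo%R : set_system R), M <= p.1 /\ M <= p.2.
Proof.
exists ([set r | M <= r], [set r | M <= r]) => //=.
by split; apply: nbhs_pinfty_ge; exact: num_real.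
Qed.

Variables (t x theta : R).
Hypothesis tn0 : t != 0.
Local Notation f := (line_integrand alpha q t x theta).
Local Notation J := (fun p : R * R => \int[mu]_(y in `[- p.1, p.2]) f y).

Let Q : R := normal_constant alpha q * dispersive_rate alpha q.+1 t x.

(** The integral over [- R1, R2] is the sum of an increment of the primitive
    on the right half-line and of one on the left half-line; the estimates of
    each half add up. *)
Let line_integral_estimates (eps : R) : 0 < eps -> exists2 M, 0 < M &
  forall p, M <= p.1 -> M <= p.2 -> `|J p| <= 2 * Q /\ `|J (M, M) - J p| <= 2 * eps.
Proof.
move=> eps0.
have tn0' : t * (-1) ^+ q.+1 != 0 by rewrite mulf_neq0// signr_eq0.
have [A A0 [bA tA]] := half_line q0 alpha1 alphaq x theta tn0 eps0.
have [A' A'0 [bA' tA']] := half_line q0 alpha1 alphaq (- x) theta tn0' eps0.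
have Qe : dispersive_rate alpha q.+1 (t * (-1) ^+ q.+1) (- x) =
    dispersive_rate alpha q.+1 t x.
  by rewrite /dispersive_rate normrN normrM normrX normrN1 expr1n mulr1.
rewrite Qe in bA'.
exists (A + A'); first exact: addr_gt0.
move=> [R1 R2] /= R1M R2M.
(* Any K beyond both ends will do: the primitive must be differentiable at
   - R1 and R2, and 1 < K. *)
pose K := 2 + R1 + R2.
have K1 : 1 < K by rewrite /K; lra.
have R1K : R1 < K by rewrite /K; lra.
have R2K : R2 < K by rewrite /K; lra.
have MK : A + A' < K by exact: le_lt_trans R1M R1K.
have M0 : 0 < A + A' by exact: addr_gt0.
have pr := primitive_on_right q alpha1 t x theta K1.
have pl := primitive_on_left q alpha1 t x theta K1.
have R1I : 0 <= R1 < K by rewrite R1K andbT; lra.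
have R2I : 0 <= R2 < K by rewrite R2K andbT; lra.
have MI : 0 <= A + A' < K by rewrite MK andbT ltW.
rewrite (line_integral_split q alpha1 t x theta K1 R1I R2I).
rewrite (line_integral_split q alpha1 t x theta K1 MI MI).
set I := line_primitive _ _ _ _ _ _ in pr pl *.
have b1 : `|I R2 - I 0| <= Q by apply: (bA _ _ _ (pr _ R2K)); lra.
have b2 : `|- I (- R1) - - I (- 0)| <= Q by apply: (bA' _ _ _ (pl _ R1K)); lra.
have b3 : `|I R2 - I (A + A')| <= eps.
  by apply: (tA _ _ _ _ _ _ _ (pr _ R2K)); lra.
have b4 : `|- I (- R1) - - I (- (A + A'))| <= eps.
  by apply: (tA' _ _ _ _ _ _ _ (pl _ R1K)); lra.
split.
  by apply: (le_trans (ler_normD _ _)); lra.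
rewrite distrC.
set u := I R2 in b1 b3 *; set v := I (- R1) in b2 b4 *.
have -> : u - I 0 + (- v - - I (- 0)) -
    (I (A + A') - I 0 + (- I (- (A + A')) - - I (- 0))) =
    (u - I (A + A')) + (- v - - I (- (A + A'))) by ring.
by apply: (le_trans (ler_normD _ _)); lra.
Qed.

Lemma line_integral_cvg : exists2 l : R,
  J p @[p --> (+oo%R, +oo%R)] --> l & `|l| <= 2 * Q.
Proof.
have cJ : cvg (J p @[p --> (+oo%R : set_system R, +oo%R : set_system R)]).
  apply: cauchy_cvg; apply: cauchy_exP => e e0.
  have [M M0 HM] : exists2 M, 0 < M & forall p, M <= p.1 -> M <= p.2 ->
      `|J p| <= 2 * Q /\ `|J (M, M) - J p| <= 2 * (e / 4).
    by apply: line_integral_estimates; rewrite divr_gt0.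
  exists (J (M, M)).
  have := near_pinfty_pair M; apply: filterS => p [p1 p2].
  have [_ H] := HM p p1 p2.
  by rewrite /ball/=; apply: (le_lt_trans H); lra.
exists (lim (J p @[p --> (+oo%R : set_system R, +oo%R : set_system R)])); first exact: cJ.
have [M M0 HM] := line_integral_estimates (@ltr01 R).
rewrite -(cvg_lim _ (cvg_norm cJ))//.
apply: limr_le; first by apply: cvgP (cvg_norm cJ).
by have := near_pinfty_pair M; apply: filterS => p [p1 p2]; exact: (HM p p1 p2).1.
Qed.

End improper.

(** * Complex-valued limits and the dispersive estimate *)

Section complex_limits.
Variable R : realType.

Lemma normc_le_sum (a b : R) : `|a +i* b| <= (`|a| + `|b|)%:C.
Proof.
rewrite normc_def/= lecR -[leRHS]ger0_norm ?addr_ge0//.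
rewrite -sqrtr_sqr ler_wsqrtr// sqrrD !real_normK ?num_real//.
by rewrite -addrA lerD2l lerDr mulrn_wge0// mulr_ge0.
Qed.

(** Convergence of the parts suffices because the modulus is at most the sum
    of their absolute values. *)
Lemma cvg_complex (T : Type) (F : set_system T) (FF : Filter F)
    (u v : T -> R) (a b : R) :
  u @ F --> a -> v @ F --> b ->
  (fun p => (u p +i* v p) : R[i]^o) @ F --> (a +i* b : R[i]^o).
Proof.
move=> ua vb; apply/cvgrPdist_lt => -[e1 e2].
rewrite ltcE/= => /andP[/eqP -> e0].
have e20 : 0 < e1 / 2 by rewrite divr_gt0.
have /cvgrPdist_lt/(_ _ e20) := ua; have /cvgrPdist_lt/(_ _ e20) := vb.
apply: filterS2 => p pu pv.
have -> : (a +i* b) - (u p +i* v p) = (a - u p) +i* (b - v p) by simpc.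
apply: (le_lt_trans (normc_le_sum _ _)); rewrite ltcR; lra.
Qed.

End complex_limits.

Theorem corollary4p3 (R : realType) (alpha : R) (b : nat) (hb : (2 <= b)%N)
    (halpha : -1 < alpha < b%:R - 1) :
  exists2 C : R, 0 < C & forall x t : R, t != 0 ->
    let f := fun xi : R =>
      cexp ('i%C * (t * xi ^+ b + x * xi)%:C) * (`|xi| `^ alpha)%:C in
    improper_integrable f /\
    `|improper_integral f| <=
      (C * (if alpha <= - (1 / 2) then
             (`|t| `^ (1 / b%:R) + `|x|) `^ (- alpha - 1)
           else
             (`|t| `^ (1 / b%:R) + `|x|)
               `^ (1 / (b%:R - 1) * (alpha - b%:R / 2 + 1)) *
             `|t| `^ (1 / (b%:R - 1) * (- alpha - 1 / 2))))%:C.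
Proof.
case: b hb halpha => [//|q]; rewrite ltnS => q0 /andP[alpha1].
move=> alphab.
have alphaq : alpha < q%:R by move: alphab; rewrite -natr1 addrK.
have NC := normal_constant_gt0 q0 alpha1.
exists (4 * normal_constant alpha q); first by rewrite mulr_gt0.
move=> x t t0 f.
have fE xi : f xi = line_integrand alpha q t x 0 xi +i*
    line_integrand alpha q t x (- (pi / 2)) xi.
  rewrite /f /cexp /line_integrand; simpc; rewrite /= expR0 !mul1r.
  by rewrite cosB cos_pihalf sin_pihalf mulr0 add0r mulr1.
have ReE : (fun xi => complex.Re (f xi)) = line_integrand alpha q t x 0.
  by apply/funext => xi; rewrite fE.
have ImE : (fun xi => complex.Im (f xi)) = line_integrand alpha q t x (- (pi / 2)).
  by apply/funext => xi; rewrite fE.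
have [l1 c1 n1] := line_integral_cvg q0 alpha1 alphaq x 0 t0.
have [l2 c2 n2] := line_integral_cvg q0 alpha1 alphaq x (- (pi / 2)) t0.
have cf : truncated_integral f p @[p --> (+oo%R, +oo%R)] --> (l1 +i* l2 : R[i]^o).
  have -> : truncated_integral f = fun p : R * R =>
      (\int[lebesgue_measure]_(y in `[- p.1, p.2]) line_integrand alpha q t x 0 y) +i*
      (\int[lebesgue_measure]_(y in `[- p.1, p.2])
        line_integrand alpha q t x (- (pi / 2)) y).
    by apply/funext => p; rewrite /truncated_integral /cintegral ReE ImE.
  exact: cvg_complex c1 c2.
split.
  split; last by apply: cvgP cf.
  move=> R1 R2; rewrite /cintegrable ReE ImE.
  pose K := 2 + `|R1| + `|R2|.
  have K1 : 1 < K by have := normr_ge0 R1; have := normr_ge0 R2; rewrite /K; lra.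
  have sub : `[- R1, R2] `<=` `[- K, K].
    apply: subset_itvScc; rewrite bnd_simp /K.
      by have := ler_norm R1; have := normr_ge0 R2; lra.
    by have := ler_norm R2; have := normr_ge0 R1; lra.
  have intK theta' := integrable_line_integrand q alpha1 t x theta' K1.
  by split; apply: integrableS (intK _) => //; exact: measurable_itv.
have -> : improper_integral f = l1 +i* l2 by exact: cvg_lim cf.
apply: (le_trans (normc_le_sum _ _)); rewrite lecR -/(dispersive_rate _ _ _ _).
by move: n1 n2; lra.
Qed.
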